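(* Let $B$ be a standard one-dimensional Brownian motion. For every $0<\alpha<1/2$ there is an $\alpha$-Hölder continuous function $f\colon\mathbb{R}^+\to\mathbb{R}$ such that, with positive probability, the set $\mathcal{Z}(B-f)=\{t>0: B(t)=f(t)\}$ has isolated points.
   Context: $\mathbb{R}^+=[0,\infty)$; $B=(B(t))_{t\ge 0}$ starts at $0$. For a real function $g$ on $\mathbb{R}^+$, $\mathcal{Z}(g)$ denotes the set of zeros of $g$ in $(0,\infty)$ (the origin is excluded). *)

(* Defs.v *)
From HB Require Import structures.
From mathcomp Require Import all_boot all_order all_algebra.
From mathcomp Require Import all_classical all_reals all_analysis.

Set Implicit Arguments.
Unset Strict Implicit.
Unset Printing Implicit Defensive.

Import Order.TTheory GRing.Theory Num.Theory.
Import numFieldNormedType.Exports.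

Local Open Scope classical_set_scope.
Local Open Scope ring_scope.

(* Functions and processes on [0, +oo[ are given as functions on all of R; the
   values at negative arguments are never used. *)

(* Taking A i = setT for some indices gives the product rule for every
   subfamily. *)
Definition mutually_independent (R : realType) (d : measure_display)
    (T : measurableType d) (P : probability T R) (n : nat)
    (X : 'I_n -> T -> R) : Prop :=
  forall A : 'I_n -> set R, (forall i, measurable (A i)) ->
    P (\bigcap_(i : 'I_n) (X i @^-1` A i)) =
    (\prod_(i < n) P (X i @^-1` A i))%E.

(* The second parameter of [normal_prob] is the standard deviation. *)
Record standard_brownian_motion (R : realType) (d : measure_display)
    (T : measurableType d) (P : probability T R) (B : R -> T -> R) : Prop := {
  bm_measurable : forall t : R, 0 <= t -> measurable_fun [set: T] (B t) ;
  bm_start : {ae P, forall w, B 0 w = 0} ;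
  bm_independent_increments : forall (n : nat) (t : nat -> R),
    0 <= t 0%N -> (forall i, (i < n)%N -> t i <= t i.+1) ->
    mutually_independent P
      (fun (i : 'I_n) (w : T) => B (t i.+1) w - B (t i) w) ;
  bm_normal_increments : forall s t : R, 0 <= s -> s < t ->
    forall A : set R, measurable A ->
    P ((fun w => B t w - B s w) @^-1` A) =
    normal_prob 0 (Num.sqrt (t - s)) A ;
  bm_continuous :
    {ae P, forall w, {within `[0, +oo[, continuous (fun t : R => B t w)}}
}.

Definition holder_continuous (R : realType) (alpha : R) (f : R -> R) : Prop :=
  exists C : R, forall s t : R, 0 <= s -> 0 <= t ->
    `|f s - f t| <= C * `|s - t| `^ alpha.

Definition zeros (R : realType) (g : R -> R) : set R :=
  [set t | 0 < t /\ g t = 0].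

(* Since paths are only almost surely continuous and P need not be complete, an
   event on path properties may fail to be measurable, although it differs from
   a measurable one by a P-negligible set. *)
Definition with_positive_probability (R : realType) (d : measure_display)
    (T : measurableType d) (P : probability T R) (A : set T) : Prop :=
  exists E : set T, [/\ measurable E, (0 < P E)%E & E `<=` A].

(* Main.v *)
(* Let [g] be the Cantor function with contraction ratio [r = 2^(-1/alpha)],
   which is [alpha]-Hölder, and let [f(t) = g((t-1)/l)] for a small [l]. Fix
   [alpha < beta < 1/2]. With probability close to 1 the Brownian path is
   [beta]-Hölder on [[1,2]] with a constant [C] not depending on [l]. A
   construction interval of level [n] has length [l r^n], so the path can take
   the central value of [f] on that interval only if its value at the left
   endpoint is within [C (l r^n)^beta] of it; the density of [B(t)] being bounded
   for [t >= 1], and as there are [2^n] such intervals, this happens somewhere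
   with probability at most a constant times
   [sum_n 2^n (l r^n)^beta = O(l^beta)], since [2 r^beta < 1]. Otherwise,
   on every construction interval the path stays on one side of the central
   value, hence meets [f] in at most one of the two subintervals, and [B - f] has
   at most one zero in [[1, 1+l]]. There is one as soon as [B(1) > 0 = f(1)] and
   [B(1+l) < 1 = f(1+l)], which has probability bounded below as [l -> 0]. *)

Require Import Defs.
From HB Require Import structures.
From mathcomp Require Import all_boot all_order all_algebra.
From mathcomp Require Import all_classical all_reals all_analysis.
From mathcomp Require Import measurable_realfun.
From mathcomp Require Import ring lra.

Import Order.TTheory GRing.Theory Num.Theory.
Import numFieldNormedType.Exports.

Local Open Scope classical_set_scope.
Local Open Scope ring_scope.

(** Self-similarity halves an error at each level, so bounds on [cantor] are proved up to
    [2^-1 ^+ n] by induction on [n]; this removes the error. *)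
Lemma ler_addgt0_half_pow (R : realType) (x y : R) :
  (forall n, x <= y + 2^-1 ^+ n) -> x <= y.
Proof.
move=> h; apply: (@ler_cvg_to _ \oo _ _ (fun=> x) (fun n => y + 2^-1 ^+ n)).
- exact: cvg_cst.
- rewrite -[X in _ --> X]addr0; apply: cvgD; first exact: cvg_cst.
  by apply: cvg_expr; rewrite ger0_norm; lra.
- by near=> n; exact: h.
Unshelve. all: by end_near. Qed.

(** * The Cantor function with contraction ratio [r] *)

Section cantor_function.
Variables (R : realType) (r : R).
Hypotheses (r0 : 0 < r) (r1 : r < 1 / 2).

(** The inverse of [u -> r * u] or of [u -> 1 - r + r * u], split at the middle of the central gap.
    Points of the gap leave [[0, 1]], where the limit is constantly 0 or 1, so that both branches
    give 1/2 on the gap. *)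
Definition cantor_shift (t : R) : R :=
  if t < 1 / 2 then t / r else (t - (1 - r)) / r.

Definition cantor_digit (t : R) : R := (1 / 2 <= t)%R%:R.

(** The first [n] digits met along the orbit of [t] under [cantor_shift], read as a binary
    expansion. *)
Fixpoint cantor_approx (n : nat) (t : R) : R :=
  if n is m.+1 then
    (cantor_digit t + cantor_approx m (cantor_shift t)) / 2
  else 0.

Definition cantor (t : R) : R := limn (cantor_approx ^~ t).

Lemma cantor_approx_ge0_le1 n t : 0 <= cantor_approx n t <= 1.
Proof.
elim: n t => [|n IH] t /=; first by rewrite lexx ler01.
have := IH (cantor_shift t); rewrite /cantor_digit.
by case: (1 / 2 <= t) => /= /andP[? ?]; apply/andP; split; lra.
Qed.

Lemma nondecreasing_cantor_approx t :
  nondecreasing_seq (cantor_approx ^~ t).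
Proof.
apply/nondecreasing_seqP => n.
elim: n t => [|n IH] t; first by have /andP[] := cantor_approx_ge0_le1 1 t.
by have /= := IH (cantor_shift t); lra.
Qed.

Lemma cvg_cantor_approx t : cantor_approx ^~ t @ \oo --> cantor t.
Proof.
apply: (@nondecreasing_is_cvgn _ (cantor_approx ^~ t)).
  exact: nondecreasing_cantor_approx.
by exists 1 => _ [n _ <-]; have /andP[] := cantor_approx_ge0_le1 n t.
Qed.

Lemma cantorE t : cantor t = (cantor_digit t + cantor (cantor_shift t)) / 2.
Proof.
have h1 : cantor_approx n.+1 t @[n --> \oo] --> cantor t.
  have := @cvg_cantor_approx t; rewrite -(cvg_shiftS (cantor_approx ^~ t)).
  exact.
have h2 : cantor_approx n.+1 t @[n --> \oo] -->
    (cantor_digit t + cantor (cantor_shift t)) / 2.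
  apply: cvgMl; apply: cvgD; first exact: cvg_cst.
  exact: cvg_cantor_approx.
exact: (cvg_unique _ h1 h2).
Qed.

Lemma cantor_ge0 t : 0 <= cantor t.
Proof.
apply: (limr_ge); first exact: cvgP (cvg_cantor_approx t).
by near=> n; have /andP[] := cantor_approx_ge0_le1 n t.
Unshelve. all: by end_near. Qed.

Lemma cantor_le1 t : cantor t <= 1.
Proof.
apply: (limr_le); first exact: cvgP (cvg_cantor_approx t).
by near=> n; have /andP[] := cantor_approx_ge0_le1 n t.
Unshelve. all: by end_near. Qed.

Lemma cantor_le0 t : t <= 0 -> cantor t = 0.
Proof.
move=> t0; apply/eqP; rewrite eq_le cantor_ge0 andbT.
apply: ler_addgt0_half_pow => n; rewrite add0r.
elim: n t t0 => [|n IH] t t0; first exact: cantor_le1.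
rewrite cantorE /cantor_digit /cantor_shift.
have -> : t < 1 / 2 by lra.
have -> : 1 / 2 <= t = false by apply/negbTE; rewrite -ltNge; lra.
have := IH (t / r); rewrite pmulr_lle0 ?invr_gt0// exprS => /(_ t0) /=; lra.
Qed.

Lemma cantor_ge1 t : 1 <= t -> cantor t = 1.
Proof.
move=> t1; apply/eqP; rewrite eq_le cantor_le1 /=.
apply: ler_addgt0_half_pow => n.
elim: n t t1 => [|n IH] t t1; first by rewrite expr0; have := cantor_ge0 t; lra.
rewrite cantorE /cantor_digit /cantor_shift.
have -> : t < 1 / 2 = false by apply/negbTE; rewrite -leNgt; lra.
have -> : 1 / 2 <= t by lra.
have : 1 <= (t - (1 - r)) / r by rewrite ler_pdivlMr//; lra.
by move=> /IH; rewrite exprS /=; lra.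
Qed.

Lemma cantor_left u : r * u <= 1 - r -> cantor (r * u) = cantor u / 2.
Proof.
move=> hu; rewrite cantorE /cantor_digit /cantor_shift.
have [h|h] := ltP (r * u) (1 / 2).
  by rewrite [r * u]mulrC mulfK ?gt_eqF// add0r.
(* In the right half of the gap the other branch applies, and both sides are 1/2. *)
rewrite (@cantor_le0 ((r * u - (1 - r)) / r)); last first.
  by rewrite pmulr_lle0 ?invr_gt0//; lra.
rewrite (@cantor_ge1 u) ?addr0// -(@ler_pM2l _ r)//; lra.
Qed.

Lemma cantor_right u : r <= 1 - r + r * u ->
  cantor (1 - r + r * u) = (1 + cantor u) / 2.
Proof.
move=> hu; rewrite cantorE /cantor_digit /cantor_shift.
have [h|h] := ltP (1 - r + r * u) (1 / 2); last first.
  by rewrite (_ : _ - (1 - r) = u * r) ?mulfK ?gt_eqF//; ring.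
rewrite (@cantor_ge1 ((1 - r + r * u) / r)); last by rewrite ler_pdivlMr//; lra.
have u0 : u <= 0 by rewrite -(@pmulr_rle0 _ r)//; lra.
by rewrite (cantor_le0 _ u0) /=; lra.
Qed.

(** By [cantor_left], values up to [1 - r] are halves of values at most 1. With [cantor_lt_half],
    this tells from the side of 1/2 on which a value lies which child contains the point. *)
Lemma cantor_gt_half u : 1 / 2 < cantor u -> 1 - r < u.
Proof.
move=> hu; rewrite ltNge; apply/negP => ur; move: hu; apply/negP; rewrite -leNgt.
have -> : u = r * (u / r) by rewrite mulrC divfK// gt_eqF.
rewrite cantor_left; last by rewrite mulrC divfK// gt_eqF.
by have := cantor_le1 (u / r); lra.
Qed.

Lemma cantor_lt_half u : cantor u < 1 / 2 -> u < r.
Proof.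
move=> hu; rewrite ltNge; apply/negP => ur; move: hu; apply/negP; rewrite -leNgt.
have E : r * ((u - (1 - r)) / r) = u - (1 - r) by rewrite mulrC divfK// gt_eqF.
have -> : u = 1 - r + r * ((u - (1 - r)) / r) by rewrite E; lra.
rewrite cantor_right; last by rewrite E; lra.
by have := cantor_ge0 ((u - (1 - r)) / r); lra.
Qed.

(* If both points lie on the same side of the central gap, self-similarity
   reproduces the bound with the same constant because [r `^ a = 1/2];
   otherwise their distance is at least the length [1 - 2 * r] of the gap. *)
Lemma cantor_holder (a : R) : 0 <= a -> r `^ a = 2^-1 -> forall s t,
  `|cantor s - cantor t| <= (1 - 2 * r) `^ (- a) * `|s - t| `^ a.
Proof.
have r2 : 0 < 1 - 2 * r by move: r1; lra.
move=> a0 ra s t; apply: ler_addgt0_half_pow => n.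
elim: n s t => [|n IH] s t.
  rewrite expr0 -[leLHS]add0r lerD ?mulr_ge0 ?powR_ge0//.
  have := cantor_ge0 s; have := cantor_ge0 t.
  have := cantor_le1 s; have := cantor_le1 t.
  by move=> ? ? ? ?; rewrite ler_norml; apply/andP; split; lra.
wlog st : s t / s <= t.
  move=> H; have [|/ltW] := leP s t; first exact: H.
  by move=> /H; rewrite distrC [in leRHS]distrC.
(* Division by [r] multiplies [a]-th powers of distances by 2, which compensates the halving of
   values in each branch. *)
have rV : (r^-1) `^ a = 2 by rewrite -powR_inv1 1?ltW// -powRrM mulN1r powRN ra invrK.
have scale x y : `|x / r - y / r| `^ a = 2 * `|x - y| `^ a.
  rewrite -mulrBl normrM powRM// mulrC; congr (_ * _).
  by rewrite ger0_norm ?rV// invr_ge0 ltW.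
have [t1|t1] := leP t (1 - r).
  have E x : x <= 1 - r -> cantor x = cantor (x / r) / 2.
    by move=> x1; rewrite -cantor_left mulrC divfK// gt_eqF.
  rewrite (E t)// (E s) ?(le_trans st)// -mulrBl normrM (@ger0_norm _ 2^-1)//.
  by have := IH (s / r) (t / r); rewrite scale exprS; lra.
have [s1|s1] := leP r s.
  have E x : r <= x -> cantor x = (1 + cantor ((x - (1 - r)) / r)) / 2.
    move=> x1; have F : r * ((x - (1 - r)) / r) = x - (1 - r).
      by rewrite mulrC divfK// gt_eqF.
    by rewrite -cantor_right F ?[1 - r + _]addrC ?subrK.
  rewrite (E t) ?(le_trans s1)// (E s)//.
  rewrite -mulrBl [X in `|X * _|](_ : _ = cantor ((s - (1 - r)) / r) -
    cantor ((t - (1 - r)) / r)); last by lra.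
  rewrite normrM (@ger0_norm _ 2^-1)//.
  have := IH ((s - (1 - r)) / r) ((t - (1 - r)) / r); rewrite scale.
  have -> : s - (1 - r) - (t - (1 - r)) = s - t by lra.
  by rewrite exprS; lra.
have h : 1 <= (1 - 2 * r) `^ (- a) * `|s - t| `^ a.
  rewrite powRN mulrC ler_pdivlMr ?mul1r; last exact: powR_gt0.
  apply: ge0_ler_powR => //; rewrite ?nnegrE; [lra|].
  by rewrite distrC ger0_norm; lra.
have := cantor_ge0 s; have := cantor_ge0 t.
have := cantor_le1 s; have := cantor_le1 t.
have : 0 <= 2^-1 ^+ n.+1 :> R by apply: exprn_ge0.
by move=> ? ? ? ? ?; apply: (@le_trans _ _ 1); [rewrite ler_norml; apply/andP; split|]; lra.
Qed.

(* The left endpoint of the [k]-th construction interval of level [n]; that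
   interval has length [r ^+ n], and the binary digits of [k] are its address. *)
Fixpoint cantor_left_end (n k : nat) : R :=
  if n is m.+1 then
    cantor_left_end m k./2 + (odd k)%:R * (1 - r) * r ^+ m
  else 0.

Lemma cantor_left_end_ge0_le n k :
  0 <= cantor_left_end n k /\ cantor_left_end n k + r ^+ n <= 1.
Proof.
have rhalf := r1; elim: n k => [|n IH] k /=; first by rewrite expr0 add0r.
have [h1 h2] := IH k./2.
have h3 : 0 <= r ^+ n by apply: exprn_ge0; apply: ltW.
have h4 : 0 <= r * r ^+ n by rewrite mulr_ge0// ltW.
have h5 : r * r ^+ n <= r ^+ n by rewrite ler_piMl//; lra.
by rewrite exprS; case: (odd k) => /=; rewrite ?mulrBl ?mul1r ?mul0r; split; lra.
Qed.

(** Induction strips the last binary digit of [k], which selects the child within its parent. Hence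
    the central gap of the interval carries the value [(k%:R + 1 / 2) / 2 ^+ n]. *)
Lemma cantor_self_similar n k u : (k < 2 ^ n)%N -> 0 <= u <= 1 ->
  cantor (cantor_left_end n k + r ^+ n * u) = (k%:R + cantor u) / 2 ^+ n.
Proof.
have rhalf := r1; elim: n k u => [|n IH] k u.
  by case: k => //= _ _; rewrite expr0 mul1r !add0r divr1.
move=> kn /andP[u0 u1].
have ru0 : 0 <= r * u by rewrite mulr_ge0// ltW.
have rur : r * u <= r by rewrite ler_piMr// ltW.
set v := (odd k)%:R * (1 - r) + r * u.
have v01 : 0 <= v <= 1.
  by rewrite /v; case: (odd k) => /=; rewrite ?mul1r ?mul0r; apply/andP; split; lra.
have -> : cantor_left_end n.+1 k + r ^+ n.+1 * u =
    cantor_left_end n k./2 + r ^+ n * v.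
  by rewrite /v /= exprS; ring.
rewrite IH//; last by rewrite ltn_half_double -mul2n -expnS.
have -> : cantor v = ((odd k)%:R + cantor u) / 2.
  rewrite /v; case: (odd k) => /=; rewrite ?mul1r ?mul0r ?add0r.
    by apply: cantor_right; lra.
  by apply: cantor_left; lra.
rewrite -[in RHS](odd_double_half k) natrD -muln2 natrM exprS.
by field; rewrite expf_neq0.
Qed.

(** Two crossings share a construction interval at every level, and the lengths [r ^+ n] tend to 0.
    The avoided number is the value of [cantor] on the central gap. *)
Lemma cantor_graph_unique (W : R -> R) (e : nat -> R) :
  (forall n k x, (k < 2 ^ n)%N ->
    cantor_left_end n k <= x <= cantor_left_end n k + r ^+ n ->
    `|W x - W (cantor_left_end n k)| <= e n) ->
  (forall n k, (k < 2 ^ n)%N ->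
    e n < `|W (cantor_left_end n k) - (k%:R + 1 / 2) / 2 ^+ n|) ->
  forall x y, 0 <= x <= 1 -> 0 <= y <= 1 ->
    W x = cantor x -> W y = cantor y -> x = y.
Proof.
have rhalf := r1; move=> osc avoid x y x01 y01 Wx Wy.
pose I n k z := cantor_left_end n k <= z <= cantor_left_end n k + r ^+ n.
(* The oscillation bound keeps [W] on one side of the central value over the
   whole interval, so all crossings sit in the same child. *)
have nested n : exists k, [/\ (k < 2 ^ n)%N, I n k x & I n k y].
  elim: n => [|n [k [kn Ix Iy]]].
    by exists 0; rewrite /I /= expr0 !add0r.
  have rn : 0 < r ^+ n by apply: exprn_gt0.
  have p2 : 0 < 2 ^+ n :> R by apply: exprn_gt0.
  set a := cantor_left_end n k.
  have coord z : I n k z -> exists2 u, 0 <= u <= 1 & z = a + r ^+ n * u.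
    move=> /andP[z1 z2]; exists ((z - a) / r ^+ n); last first.
      by rewrite mulrC divfK ?gt_eqF// addrC subrK.
    apply/andP; split; first by rewrite divr_ge0 ?subr_ge0// ltW.
    by rewrite ler_pdivrMr// mul1r lerBlDl.
  have [] := (avoid n k kn, osc n k).
  rewrite -/a => av os; set v := (k%:R + 1 / 2) / 2 ^+ n in av *.
  have [lt|gt|eq] := ltgtP (W a) v; last first.
  (* Equality would make [e n] negative, yet it bounds an absolute value. *)
  - move: av; rewrite eq subrr normr0 => av.
    by have := le_lt_trans (le_trans (normr_ge0 _) (os x kn Ix)) av; rewrite ltxx.
  (* Here [W] exceeds [v] on the whole interval, so a crossing has [1 / 2 < cantor u] and lies in
     the right child. *)
  - have right z : I n k z -> W z = cantor z -> I n.+1 k.*2.+1 z.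
      move=> Iz Wz; have [u u01 zE] := coord z Iz.
      have : v < cantor z.
        rewrite -Wz; have := os z kn Iz; move: av.
        rewrite gtr0_norm ?subr_gt0// ler_norml => av /andP[]; lra.
      rewrite zE cantor_self_similar// ltr_pM2r ?invr_gt0// ltrD2l.
      move=> /cantor_gt_half u1.
      rewrite /I /= /a uphalf_double odd_double /= mul1r -/a exprS.
      have /andP[u0' u1'] := u01.
      have : r ^+ n * (1 - r) <= r ^+ n * u by rewrite ler_pM2l// ltW.
      have : r ^+ n * u <= r ^+ n by rewrite ler_piMr// ltW.
      by move=> ? ?; apply/andP; split; lra.
    exists k.*2.+1; split; [|exact: right..].
    by rewrite expnS mul2n ltn_Sdouble.
  - have left z : I n k z -> W z = cantor z -> I n.+1 k.*2 z.
      move=> Iz Wz; have [u u01 zE] := coord z Iz.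
      have : cantor z < v.
        rewrite -Wz; have := os z kn Iz; move: av.
        rewrite ltr0_norm ?subr_lt0// ler_norml => av /andP[]; lra.
      rewrite zE cantor_self_similar// ltr_pM2r ?invr_gt0// ltrD2l.
      move=> /cantor_lt_half u1.
      rewrite /I /= /a doubleK odd_double /= !mul0r addr0 -/a exprS.
      have /andP[u0' u1'] := u01.
      have : r ^+ n * u <= r ^+ n * r by rewrite ler_pM2l// ltW.
      have : 0 <= r ^+ n * u by rewrite mulr_ge0// ltW.
      by move=> ? ?; apply/andP; split; lra.
    exists k.*2; split; [|exact: left..].
    by rewrite expnS mul2n ltn_double.
apply/eqP; rewrite -subr_eq0 -normr_le0; apply: ler_addgt0_half_pow => n.
rewrite add0r; have [k [_ /andP[x1 x2] /andP[y1 y2]]] := nested n.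
apply: (@le_trans _ _ (r ^+ n)); first by rewrite ler_norml; apply/andP; split; lra.
by apply: lerXn2r; rewrite ?nnegrE; move: r0; lra.
Qed.

End cantor_function.

Arguments cantor {R} r t.
Arguments cantor_left_end {R} r n k.

(** * Gaussian estimates *)

Section normal_bounds.
Variable R : realType.
Implicit Types s x y a b : R.

Lemma normal_peak_double s : normal_peak (2 * s) = normal_peak s / 2.
Proof.
rewrite /normal_peak exprMn -mulrA -mulrnAr sqrtrM ?exprn_ge0//.
by rewrite sqrtr_sqr ger0_norm// invfM mulrC.
Qed.

(* On the tail the density is at most [2 * expR (- x ^+ 2 / (4 * s ^+ 2))] times
   the density with doubled deviation, whose total mass is 1. *)
Lemma normal_prob_tail s x : 0 < s -> 0 <= x ->
  (normal_prob 0%R s [set y | (x < `|y|)%R] <=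
    (2 * expR (- (x ^+ 2 / (4 * s ^+ 2))))%:E)%E.
Proof.
move=> s0 x0; rewrite /normal_prob.
set c := 2 * _.
have c0 : 0 <= c by rewrite mulr_ge0// expR_ge0.
have mA : measurable [set y : R | (x < `|y|)%R].
  by apply: open_measurable; apply: open_comp (@open_gt _ x) => y _; exact: norm_continuous.
have s20 : 2 * s != 0 by rewrite mulf_neq0// gt_eqF.
have mpdf t : measurable_fun [set: R] (EFin \o normal_pdf 0 t).
  by apply/measurable_EFinP; exact: measurable_normal_pdf.
apply: (@le_trans _ _ (\int[lebesgue_measure]_(y in [set y | (x < `|y|)%R])
    (c%:E * (normal_pdf 0 (2 * s) y)%:E))%E).
  apply: ge0_le_integral => //.
  - by move=> y _; rewrite lee_fin normal_pdf_ge0.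
  - by apply: measurable_funTS; exact: mpdf.
  - by apply: measurable_funTS; apply: measurable_funeM; exact: mpdf.
  move=> y /= xy; rewrite -EFinM lee_fin !normal_pdfE ?gt_eqF//; last by rewrite mulr_gt0.
  rewrite normal_peak_double /normal_fun /c.
  set p := normal_peak s; have p0 : 0 <= p by exact: normal_peak_ge0.
  rewrite [leRHS](_ : _ = p * (expR (- (x ^+ 2 / (4 * s ^+ 2))) *
     expR (- (y - 0) ^+ 2 / ((2 * s) ^+ 2 *+ 2)))); last by field.
  rewrite ler_wpM2l// -expRD ler_expR subr0.
  have xy2 : x ^+ 2 <= y ^+ 2.
    by rewrite -[y ^+ 2]real_normK ?num_real// lerXn2r ?nnegrE ?normr_ge0// ltW.
  have -> : - y ^+ 2 / (s ^+ 2 *+ 2) = - (4 * y ^+ 2) / (8 * s ^+ 2).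
    by field; rewrite gt_eqF.
  have -> : - (x ^+ 2 / (4 * s ^+ 2)) + - y ^+ 2 / ((2 * s) ^+ 2 *+ 2) =
     - (2 * x ^+ 2 + y ^+ 2) / (8 * s ^+ 2).
    by field; rewrite gt_eqF.
  rewrite ler_pM2r ?invr_gt0 ?mulr_gt0 ?exprn_gt0//.
  by have := sqr_ge0 y; lra.
rewrite ge0_integralZl//; last 2 first.
- by apply: measurable_funTS; exact: mpdf.
- by move=> y _; rewrite lee_fin normal_pdf_ge0.
rewrite -[leRHS]mule1 lee_wpmul2l ?lee_fin//.
rewrite -(integral_normal_pdf 0 (2 * s)).
apply: ge0_subset_integral => //; first exact: mpdf.
by move=> y _; rewrite lee_fin normal_pdf_ge0.
Qed.

(** The density is at most its peak, and [2 * pi * s ^+ 2] is at least 1. The bound serves times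
    from 1 on. *)
Lemma normal_prob_itv_le s a b : 1 <= s -> a <= b ->
  (normal_prob 0%R s `[a, b] <= (b - a)%:E)%E.
Proof.
move=> s1 ab; rewrite /normal_prob.
apply: (@le_trans _ _ (\int[lebesgue_measure]_(y in `[a, b]) (cst 1%E y))%E).
  apply: ge0_le_integral => //.
  - by move=> y _; rewrite lee_fin normal_pdf_ge0.
  - by apply: measurable_funTS; apply/measurable_EFinP; exact: measurable_normal_pdf.
  move=> y _; rewrite lee_fin; apply: (le_trans (normal_pdf_ub _ _ _)).
    by rewrite gt_eqF// (lt_le_trans ltr01).
  rewrite /normal_peak invf_le1 ?sqrtr_gt0; last first.
    by rewrite mulrn_wgt0 ?mulr_gt0 ?exprn_gt0 ?pi_gt0// (lt_le_trans ltr01).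
  rewrite -[1]sqrtr1 ler_wsqrtr//.
  have := pi_ge2 R => pi2.
  have s2 : 1 <= s ^+ 2 by rewrite exprn_ege1.
  have : 1 * 2 <= s ^+ 2 * pi by apply: ler_pM.
  lra.
rewrite integral_cst//= mul1e lebesgue_measure_itv/= lte_fin.
by case: ifP => // _; rewrite lee_fin subr_ge0.
Qed.

Lemma normal_prob_itv_gt0 s a b : 0 < s -> a < b ->
  (0 < normal_prob 0%R s `]a, b[)%E.
Proof.
move=> s0 ab; rewrite /normal_prob.
(* [M] bounds the absolute value on the interval, so [c] bounds the density there from below. *)
set M := `|a| + `|b|.
set c := normal_peak s * expR (- M ^+ 2 / (s ^+ 2 *+ 2)).
have c0 : 0 < c by rewrite mulr_gt0 ?expR_gt0// normal_peak_gt0// gt_eqF.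
apply: (@lt_le_trans _ _ (\int[lebesgue_measure]_(y in `]a, b[) (cst c%:E y))%E).
  rewrite integral_cst//= lebesgue_measure_itv/= lte_fin ab.
  by rewrite mule_gt0// lte_fin subr_gt0.
apply: ge0_le_integral => //.
- by move=> y _; rewrite lee_fin ltW.
- by apply: measurable_funTS; apply/measurable_EFinP; exact: measurable_normal_pdf.
move=> y /=; rewrite in_itv/= => /andP[ay yb].
rewrite lee_fin normal_pdfE ?gt_eqF// /c ler_wpM2l ?normal_peak_ge0//.
rewrite /normal_fun ler_expR subr0 ler_pM2r ?invr_gt0 ?mulrn_wgt0 ?exprn_gt0//.
rewrite lerN2 -[y ^+ 2]real_normK ?num_real// lerXn2r ?nnegrE ?addr_ge0//.
rewrite ler_norml /M; have := ler_norm b; have := ler_norm (- a); rewrite normrN.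
by have := normr_ge0 a; have := normr_ge0 b; move=> ? ? ? ?; apply/andP; split; lra.
Qed.

(* [expR (- y) <= m! / y ^+ m] with [m] large enough that [4 <= theta ^+ m]. *)
Lemma expR_geometric_decay (theta eps : R) : 1 < theta -> 0 < eps ->
  exists2 L : R, 0 < L &
    forall n, 2 * expR (- (L ^+ 2 * theta ^+ n)) <= eps * 4^-1 ^+ n.
Proof.
move=> theta1 eps0; have t0 : 0 < theta by lra.
have [m m4] : exists m, 4 <= theta ^+ m.+1.
  have : theta^-1 ^+ j @[j --> \oo] --> 0.
    by apply: cvg_expr; rewrite ger0_norm ?invr_ge0 ?invf_lt1; lra.
  move/cvgrPdist_lt => /(_ 4^-1)[]; first lra.
  move=> N _ /(_ N.+1 (leqnSn _)) /=.
  rewrite sub0r normrN ger0_norm ?exprn_ge0 ?invr_ge0 ?(ltW t0)//.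
  rewrite exprVn ltf_pV2 ?posrE ?exprn_gt0//.
  by move=> ?; exists N; exact: ltW.
set F : R := (m.+1)`!%:R; have F0 : 0 < F by rewrite ltr0n fact_gt0.
(* [1 <= L] allows all but one factor [L] of [y ^+ m.+1] to be dropped, and [2 * F <= eps * L]
   yields the constant. *)
set L := 1 + 2 * F / eps.
have L1 : 1 <= L by rewrite lerDl divr_ge0 ?mulr_ge0// ltW.
have L0 : 0 < L by lra.
exists L => // n.
set y := L ^+ 2 * theta ^+ n.
have y0 : 0 < y by rewrite mulr_gt0 ?exprn_gt0.
have ym : L * 4 ^+ n <= y ^+ m.+1.
  rewrite /y exprMn; apply: ler_pM; rewrite ?exprn_ge0//; [lra| |].
    by rewrite -exprM mulnS exprD expr2 -mulrA ler_peMr// ?mulr_ege1 ?exprn_ege1//; lra.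
  by rewrite -exprM mulnC exprM lerXn2r ?nnegrE// exprn_ge0// ltW.
have E : L * 4 ^+ n / F <= expR y.
  apply: le_trans (expR_ge1Dxn m (ltW y0)).
  by rewrite -/F -[leLHS]add0r lerD// ler_pM2r ?invr_gt0.
have p4 : 0 < 4 ^+ n :> R by rewrite exprn_gt0.
rewrite expRN; apply: (@le_trans _ _ (2 * (L * 4 ^+ n / F)^-1)).
  by rewrite ler_pM2l// lef_pV2 ?posrE ?expR_gt0// divr_gt0 ?mulr_gt0.
have -> : 2 * (L * 4 ^+ n / F)^-1 = 2 * F / L * (4 ^+ n)^-1.
  by field; rewrite !gt_eqF.
rewrite exprVn ler_pM2r ?invr_gt0// ler_pdivrMr//.
have -> : eps * L = eps + 2 * F by rewrite /L; field; rewrite gt_eqF.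
by rewrite lerDr ltW.
Qed.

End normal_bounds.

(** Level [n] has [2 ^ n] events and contributes at most [c * rho ^+ n]; the levels form a geometric
    series. *)
Lemma probability_binary_tree_le (R : realType) (d : measure_display)
    (T : measurableType d) (P : probability T R) (F : nat -> nat -> set T)
    (c rho : R) : 0 <= c -> 0 <= rho -> rho < 1 ->
  (forall n k, (k < 2 ^ n)%N -> measurable (F n k)) ->
  (forall n k, (k < 2 ^ n)%N -> (P (F n k) <= (c * (rho / 2) ^+ n)%:E)%E) ->
  measurable (\bigcup_n \big[setU/set0]_(k < 2 ^ n) F n k) /\
  (P (\bigcup_n \big[setU/set0]_(k < 2 ^ n) F n k) <= (c / (1 - rho))%:E)%E.
Proof.
move=> c0 rho0 rho1 mF PF.
have mU n : measurable (\big[setU/set0]_(k < 2 ^ n) F n k).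
  by apply: bigsetU_measurable => k _; exact: mF.
have mUU : measurable (\bigcup_n \big[setU/set0]_(k < 2 ^ n) F n k).
  exact: bigcup_measurable.
split=> //; apply: (le_trans (generalized_Boole_inequality _ mU mUU)).
apply: lime_le; first by apply: is_cvg_nneseries => n _ _; exact: measure_ge0.
near=> N.
apply: (@le_trans _ _ (\sum_(0 <= n < N) (c * rho ^+ n)%:E)%E).
  apply: lee_sum => n _.
  apply: (le_trans (Boole_inequality P (A := F n) (mF n))).
  apply: (@le_trans _ _ (\sum_(k < 2 ^ n) (c * (rho / 2) ^+ n)%:E)%E).
    by apply: lee_sum => k _; exact: PF.
  rewrite sumEFin sumr_const card_ord lee_fin -[leLHS]mulr_natr natrX -mulrA -exprMn.
  by rewrite divfK.
rewrite sumEFin lee_fin.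
have -> : \sum_(0 <= n < N) c * rho ^+ n = series (geometric c rho) N by [].
rewrite geometric_seriesE ?lt_eqF//.
rewrite ler_pM2r ?invr_gt0 ?subr_gt0//.
by rewrite ler_piMr// gerBl exprn_ge0.
Unshelve. all: by end_near. Qed.

(** * Kolmogorov chaining along dyadic points of [[1, 2]], for a deterministic function *)

Lemma dyadic_chaining (R : realType) (b : R -> R) (K q : R) :
  0 <= K -> 0 < q -> q < 1 ->
  (forall t, 1 <= t <= 2 -> {for t, continuous b}) ->
  (forall n k, (k < 2 ^ n)%N ->
    `|b (1 + k.+1%:R / 2 ^+ n) - b (1 + k%:R / 2 ^+ n)| <= K * q ^+ n) ->
  forall n (s t : R), 1 <= s -> s <= t -> t <= 2 -> t - s <= 2^-1 ^+ n ->
    `|b t - b s| <= K * (1 + 2 / (1 - q)) * q ^+ n.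
Proof.
move=> K0 q0 q1 cb inc n s t s1 st t2 tsn.
(* [D m x] rounds [x] down to the grid of mesh [2^-1 ^+ m]; the index [k m x] reaches [2 ^ m] at
   [x = 2]. *)
pose k m (x : R) := Num.truncn (2 ^+ m * (x - 1)).
pose D m x : R := 1 + (k m x)%:R / 2 ^+ m.
have p2 m : 0 < 2 ^+ m :> R by apply: exprn_gt0.
have kP m x : 1 <= x -> (k m x)%:R <= 2 ^+ m * (x - 1) < (k m x)%:R + 1.
  by move=> x1; rewrite natr1; apply: truncn_itv; rewrite mulr_ge0 ?subr_ge0// ltW.
have kle m x : 1 <= x -> x <= 2 -> (k m x <= 2 ^ m)%N.
  move=> x1 x2; have /andP[+ _] := kP m x x1.
  rewrite -(ler_nat R) natrX => /le_trans; apply.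
  by rewrite ler_piMr ?(ltW (p2 m))//; lra.
(* Refining the grid moves the approximation by at most one cell of the finer level. *)
have step m x : 1 <= x -> x <= 2 -> `|b (D m.+1 x) - b (D m x)| <= K * q ^+ m.+1.
  move=> x1 x2; have /andP[a1 a2] := kP m x x1.
  have /andP[c1 c2] := kP m.+1 x x1.
  have h1 : (k m x).*2%:R < (k m.+1 x).+1%:R :> R.
    by rewrite -natr1 -muln2 natrM; move: c2; rewrite exprS; lra.
  have h2 : (k m.+1 x)%:R < (k m x).*2.+2%:R :> R.
    by rewrite -addn2 natrD -muln2 natrM; move: c1; rewrite exprS; lra.
  rewrite !ltr_nat in h1 h2.
  have DE : D m x = 1 + (k m x).*2%:R / 2 ^+ m.+1.
    by rewrite /D -muln2 natrM exprS; congr (_ + _); field; rewrite gt_eqF.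
  have [E|E] : k m.+1 x = (k m x).*2 \/ k m.+1 x = (k m x).*2.+1.
  - move: h1 h2; rewrite ltnS leq_eqVlt => /orP[/eqP->|]; first by left.
    by move=> h3 h4; right; apply/eqP; rewrite eqn_leq h3 -ltnS h4.
  - by rewrite DE /D E subrr normr0 mulr_ge0// exprn_ge0// ltW.
  - rewrite DE /D E; apply: inc; rewrite -ltnS -E.
    by rewrite ltnS; exact: kle.
(* Each step's [q ^+ (n + j).+1] is relaxed to [q ^+ (n + j)] to match this closed form of the
   geometric sum. *)
have tail x j : 1 <= x -> x <= 2 ->
    `|b (D (n + j)%N x) - b (D n x)| <= K * q ^+ n * (1 - q ^+ j) / (1 - q).
  move=> x1 x2; elim: j => [|j IH].
    by rewrite addn0 subrr normr0 expr0 subrr mulr0 mul0r.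
  have h := step (n + j)%N x x1 x2.
  rewrite addnS; set u := b _ in h *; set v := b (D n x) in IH *.
  set w := b (D (n + j)%N x) in h IH *.
  have -> : u - v = (u - w) + (w - v) by lra.
  apply: (le_trans (ler_normD _ _)); apply: (le_trans (lerD h IH)).
  have -> : K * q ^+ n * (1 - q ^+ j.+1) / (1 - q) =
      K * q ^+ (n + j)%N + K * q ^+ n * (1 - q ^+ j) / (1 - q).
    by rewrite exprD exprS; field; rewrite subr_eq0 gt_eqF.
  rewrite lerD2r ler_wpM2l// exprS ler_piMl// ?exprn_ge0// ltW//.
have Dcvg x : 1 <= x -> D (n + j)%N x @[j --> \oo] --> x.
  move=> x1; apply/cvgrPdist_le => e e0.
  have : (2^-1 : R) ^+ j @[j --> \oo] --> 0 by apply: cvg_expr; rewrite ger0_norm; lra.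
  move/cvgrPdist_le => /(_ e e0); apply: filterS => j; rewrite sub0r normrN => he.
  apply: le_trans he; rewrite [leRHS]ger0_norm ?exprn_ge0//.
  have /andP[a1 a2] := kP (n + j)%N x x1.
  have -> : x - D (n + j)%N x =
      (2 ^+ (n + j) * (x - 1) - (k (n + j)%N x)%:R) * 2^-1 ^+ (n + j).
    by rewrite /D exprVn; field; rewrite gt_eqF.
  rewrite normrM [X in _ * X]ger0_norm ?exprn_ge0//.
  apply: (@le_trans _ _ (1 * 2^-1 ^+ (n + j))).
    by rewrite ler_pM2r ?exprn_gt0// ler_norml; apply/andP; split; lra.
  by rewrite mul1r exprD ler_piMl ?exprn_ge0// exprn_ile1//; lra.
have lim x : 1 <= x -> x <= 2 -> `|b x - b (D n x)| <= K * q ^+ n / (1 - q).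
  move=> x1 x2; have cx : {for x, continuous b} by apply: cb; rewrite x1.
  have : `|b (D (n + j)%N x) - b (D n x)| @[j --> \oo] --> `|b x - b (D n x)|.
    apply: cvg_norm; apply: cvgB; last exact: cvg_cst.
    by apply: continuous_cvg => //; exact: Dcvg.
  move=> c; rewrite -(cvg_lim _ c)//; apply: limr_le; first exact: (cvgP _ c).
  near=> j; apply: le_trans (tail x j x1 x2) _.
  rewrite ler_pM2r ?invr_gt0 ?subr_gt0//.
  have qe m : 0 <= q ^+ m by rewrite exprn_ge0// ltW.
  by rewrite ler_piMr ?mulr_ge0// gerBl.
have t1 : 1 <= t by lra.
have s2 : s <= 2 by lra.
(* Points at distance at most [2^-1 ^+ n] round down to equal or adjacent grid points. With the two
   tails this gives the constant [1 + 2 / (1 - q)]. *)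
have mid : `|b (D n t) - b (D n s)| <= K * q ^+ n.
  have /andP[a1 a2] := kP n t t1.
  have /andP[c1 c2] := kP n s s1.
  have h0 : 2 ^+ n * (t - s) <= 1.
    rewrite -(@ler_pM2l _ (2^-1 ^+ n)) ?exprn_gt0// mulrA -exprMn mulVf//.
    by rewrite expr1n mul1r mulr1.
  have h3 : 2 ^+ n * (s - 1) <= 2 ^+ n * (t - 1) by rewrite ler_pM2l//; lra.
  have h1 : (k n s)%:R < (k n t).+1%:R :> R by rewrite -natr1; lra.
  have h2 : (k n t)%:R < (k n s).+2%:R :> R.
    by rewrite -addn2 natrD; move: h0; rewrite !mulrBr in a1 a2 c1 c2 *; lra.
  rewrite !ltr_nat in h1 h2.
  have [E|E] : k n t = k n s \/ k n t = (k n s).+1.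
  - move: h1 h2; rewrite ltnS leq_eqVlt => /orP[/eqP->|]; first by left.
    by move=> h4 h5; right; apply/eqP; rewrite eqn_leq h4 -ltnS h5.
  - by rewrite /D E subrr normr0 mulr_ge0// exprn_ge0// ltW.
  - by rewrite /D E; apply: inc; rewrite -E; exact: kle.
have -> : K * (1 + 2 / (1 - q)) * q ^+ n =
  K * q ^+ n / (1 - q) + K * q ^+ n + K * q ^+ n / (1 - q) by lra.
have -> : b t - b s = (b t - b (D n t)) + (b (D n t) - b (D n s)) - (b s - b (D n s)).
  by lra.
apply: (le_trans (ler_normB _ _)); rewrite lerD ?lim//.
by apply: (le_trans (ler_normD _ _)); rewrite lerD ?lim.
Unshelve. all: by end_near. Qed.

Lemma dyadic_bracket (R : realType) (h : R) : 0 < h -> h <= 1 ->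
  exists n, h <= 2^-1 ^+ n <= 2 * h.
Proof.
move=> h0 h1; have ex : exists n, 2^-1 ^+ n.+1 < h.
  have : (2^-1 : R) ^+ j @[j --> \oo] --> 0 by apply: cvg_expr; rewrite ger0_norm; lra.
  move/cvgrPdist_lt => /(_ h h0) [N _ /(_ N.+1 (leqnSn _))] /=.
  by rewrite sub0r normrN ger0_norm ?exprn_ge0// => ?; exists N.
have [n nh nmin] := ex_minnP ex; exists n; apply/andP; split; last first.
  by move: nh; rewrite exprS; lra.
case: n nh nmin => [|n] nh nmin; first by rewrite expr0.
by rewrite leNgt; apply/negP => /nmin; rewrite ltnn.
Qed.

Lemma powR_exprn (R : realType) (x a : R) n : 0 <= x ->
  (x ^+ n) `^ a = (x `^ a) ^+ n.
Proof.
move=> x0; elim: n => [|n IH]; first by rewrite !expr0 powR1.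
by rewrite !exprS powRM ?exprn_ge0// IH.
Qed.

(** The dyadic power bracketing [h] may be as large as [2 * h], whence the factor 2 to the power
    [beta]. *)
Lemma dyadic_chaining_holder (R : realType) (b : R -> R) (K beta : R) :
  0 <= K -> 0 < beta ->
  (forall t, 1 <= t <= 2 -> {for t, continuous b}) ->
  (forall n k, (k < 2 ^ n)%N ->
    `|b (1 + k.+1%:R / 2 ^+ n) - b (1 + k%:R / 2 ^+ n)| <=
    K * (2^-1 `^ beta) ^+ n) ->
  forall h s t : R, 0 < h -> h <= 1 -> 1 <= s -> s <= t -> t <= 2 -> t - s <= h ->
    `|b t - b s| <=
    K * (1 + 2 / (1 - 2^-1 `^ beta)) * 2 `^ beta * h `^ beta.
Proof.
move=> K0 beta0 cb inc h s t h0 h1 s1 st t2 ts.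
set q := 2^-1 `^ beta in inc *.
have q0 : 0 < q by apply: powR_gt0.
have q1 : q < 1.
  have h2 : 2^-1 < 1 :> R by lra.
  by have := gt0_ltr_powR beta0 _ _ h2; rewrite powR1; apply; rewrite nnegrE.
have [n /andP[n1 n2]] := dyadic_bracket _ _ h0 h1.
have := dyadic_chaining _ _ _ _ K0 q0 q1 cb inc n s t s1 st t2 (le_trans ts n1).
move=> /le_trans; apply; rewrite -!mulrA ler_wpM2l// ler_wpM2l//.
  by rewrite addr_ge0// divr_ge0// subr_ge0 ltW.
have -> : q ^+ n = (2^-1 ^+ n) `^ beta.
  by rewrite /q powR_exprn.
rewrite -powRM ?(ltW h0)//.
apply: (ge0_ler_powR (ltW beta0) _ _ n2); rewrite nnegrE ?exprn_ge0//.
by rewrite mulr_ge0// ltW.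
Qed.

Lemma ltr_half_powR (R : realType) (x y : R) : x < y ->
  2^-1 `^ y < 2^-1 `^ x.
Proof.
move=> xy; rewrite /powR gt_eqF// ltr_expR ltr_nM2r//.
by rewrite ln_lt0//; apply/andP; split; lra.
Qed.

(** * A deterministic criterion for an isolated zero *)

Lemma holder_bound_continuous (R : realType) (f : R -> R) (C a : R) :
  0 < a -> (forall s t, `|f s - f t| <= C * `|s - t| `^ a) -> continuous f.
Proof.
move=> a0 hf z; apply/cvgrPdist_le => e e0.
have C1 : 0 < `|C| + 1 by rewrite ltr_wpDl.
pose h := (e / (`|C| + 1)) `^ a^-1.
have h0 : 0 < h by rewrite powR_gt0// divr_gt0.
have ha : h `^ a = e / (`|C| + 1).
  by rewrite /h -powRrM mulVf ?gt_eqF// powRr1// divr_ge0// ltW.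
apply: filterS (nbhsx_ballx z h h0) => t; rewrite -ball_normE /= => zth.
apply: (le_trans (hf z t)).
have zt : `|z - t| `^ a <= e / (`|C| + 1).
  rewrite -ha; apply: (ge0_ler_powR (ltW a0)); rewrite ?nnegrE ?(ltW h0)//.
  exact: ltW.
apply: (@le_trans _ _ ((`|C| + 1) * (e / (`|C| + 1)))); last first.
  by rewrite mulrC divfK// gt_eqF.
apply: (le_trans (ler_wpM2r (powR_ge0 _ _) (ler_norm C))).
by apply: ler_pM => //; rewrite ?powR_ge0// lerDl.
Qed.

(** Existence comes from the intermediate value theorem on [[1, 1 + l]], uniqueness from
    [cantor_graph_unique] for the path rescaled to [[0, 1]]. *)
Lemma isolated_cantor_crossing (R : realType) (r l C beta a : R) (b : R -> R) :
  0 < r -> r < 1 / 2 -> 0 < a -> r `^ a = 2^-1 -> 0 < l -> l <= 1 ->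
  (forall t, 1 <= t <= 2 -> {for t, continuous b}) ->
  (forall h s t : R, 0 < h -> h <= 1 -> 1 <= s -> s <= t -> t <= 2 -> t - s <= h ->
    `|b t - b s| <= C * h `^ beta) ->
  (forall n k, (k < 2 ^ n)%N -> C * (l * r ^+ n) `^ beta <
    `|b (1 + l * cantor_left_end r n k) - (k%:R + 1 / 2) / 2 ^+ n|) ->
  0 < b 1 -> b (1 + l) < 1 ->
  isolated (zeros (fun t => b t - cantor r ((t - 1) / l))) !=set0.
Proof.
move=> r0 r1 a0 ra l0 l1 cb osc avoid b1 bl.
have cc : continuous (cantor r : R -> R).
  apply: (@holder_bound_continuous _ _ ((1 - 2 * r) `^ (- a)) a a0).
  exact: cantor_holder (ltW a0) ra.
have cf : continuous (fun t : R => cantor r ((t - 1) / l)).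
  move=> t; apply: (@continuous_comp _ _ _ (fun t : R => (t - 1) / l)); last exact: cc.
  by apply: cvgMl; apply: cvgB; [exact: cvg_id|exact: cvg_cst].
have [z] : exists2 z, z \in `[1, 1 + l] & b z - cantor r ((z - 1) / l) = 0.
  apply: IVT; first lra.
    apply: continuous_in_subspaceT => t; rewrite inE/= in_itv/= => /andP[t1 t2].
    by apply: cvgB; [apply: cb; apply/andP; split; lra|exact: cf].
  rewrite subrr mul0r cantor_le0// subr0 [1 + l]addrC addrK divff ?gt_eqF//.
  rewrite [l + 1]addrC cantor_ge1//.
  by rewrite ge_min le_max; apply/andP; split; apply/orP; [right|left]; lra.
rewrite in_itv/= => /andP[z1 z2] bz.
have uniq y : 1 <= y -> y <= 1 + l -> b y - cantor r ((y - 1) / l) = 0 -> y = z.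
  move=> y1 y2 by0.
  pose W x := b (1 + l * x).
  have lE t : 1 + l * ((t - 1) / l) = t.
    by rewrite mulrC divfK ?gt_eqF// addrC subrK.
  have in01 t : 1 <= t -> t <= 1 + l -> 0 <= (t - 1) / l <= 1.
    move=> t1 t2; rewrite divr_ge0 ?subr_ge0 ?(ltW l0)//= ler_pdivrMr// mul1r.
    by lra.
  have : (y - 1) / l = (z - 1) / l.
    apply: (@cantor_graph_unique _ r r0 r1 W (fun n => C * (l * r ^+ n) `^ beta)).
    - move=> n k x kn /andP[x1 x2].
      have [e0 e1] := @cantor_left_end_ge0_le _ r r0 r1 n k.
      have rn0 : 0 < r ^+ n by apply: exprn_gt0.
      have rn1 : r ^+ n <= 1 by lra.
      have h0 : 0 < l * r ^+ n by rewrite mulr_gt0.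
      have h1 : l * r ^+ n <= 1 by rewrite -(mulr1 1) ler_pM// ltW.
      apply: osc => //.
      + by rewrite lerDl mulr_ge0// ltW.
      + by rewrite lerD2l ler_pM2l.
      + have : l * x <= 1 * 1 by rewrite ler_pM//; lra.
        lra.
      + rewrite opprD addrACA subrr add0r -mulrBr ler_pM2l//; lra.
    - exact: avoid.
    - exact: in01.
    - exact: in01.
    - by rewrite /W lE; apply/eqP; rewrite -subr_eq0 by0.
    - by rewrite /W lE; apply/eqP; rewrite -subr_eq0 bz.
  by move=> /(congr1 (fun x => 1 + l * x)); rewrite !lE.
(* Strict signs at both ends put the zero in the open interval, which then isolates it. *)
have z1' : 1 < z.
  rewrite lt_neqAle z1 andbT; apply/eqP => zE; move: bz.
  rewrite -zE subrr mul0r cantor_le0// subr0 => b10.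
  by move: b1; rewrite b10 ltxx.
have z2' : z < 1 + l.
  rewrite lt_neqAle z2 andbT; apply/eqP => zE; move: bz.
  rewrite zE [1 + l]addrC addrK divff ?gt_eqF// [l + 1]addrC cantor_ge1// => b10.
  by move: bl; rewrite -subr_lt0 b10 ltxx.
exists z; split; first by rewrite inE; split => //; lra.
exists [set` `]1, 1 + l[]; first by apply: near_in_itvoo; rewrite in_itv/= z1'.
apply/seteqP; split => [y [/= + [_ y0]]|y ->].
  by rewrite in_itv/= => /andP[y1 y2]; apply: uniq => //; exact: ltW.
by split; [rewrite /= in_itv/= z1'|split => //; lra].
Qed.

(** * Exceptional events of small probability for Brownian motion *)

Section brownian_events.
Variables (R : realType) (d : measure_display) (T : measurableType d).
Variables (P : probability T R) (B : R -> T -> R).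
Hypothesis hB : standard_brownian_motion P B.

Let measurable_increment s t : 0 <= s -> 0 <= t ->
  measurable_fun [set: T] (fun w => B t w - B s w).
Proof.
by move=> s0 t0; apply: measurable_funB; exact: bm_measurable hB _ _.
Qed.

(** With [q] equal to 2 to the power [- beta], the level-[n] tail is at most [2 * expR (- (L ^+ 2 *
    (2 * q ^+ 2) ^+ n))], and [beta < 1 / 2] says exactly that [2 * q ^+ 2] exceeds 1. *)
Lemma brownian_dyadic_increments (beta eps : R) : beta < 1 / 2 -> 0 < eps ->
  exists K (G : set T), [/\ 0 <= K, measurable G, (P G <= eps%:E)%E &
    forall w, ~ G w -> forall n k, (k < 2 ^ n)%N ->
      `|B (1 + k.+1%:R / 2 ^+ n) w - B (1 + k%:R / 2 ^+ n) w| <=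
      K * (2^-1 `^ beta) ^+ n].
Proof.
move=> betah eps0; set q := 2^-1 `^ beta.
have q0 : 0 < q by apply: powR_gt0.
have theta1 : 1 < 2 * q ^+ 2.
  rewrite -ltr_pdivrMl// mulr1 /q -powR_mulrn ?powR_ge0// -powRrM.
  by rewrite -[ltLHS]powRr1// ltr_half_powR//; lra.
have eps2 : 0 < eps / 2 by lra.
(* At [eps / 2 * 4^-1 ^+ n] for each of the [2 ^ n] increments, the levels sum to [eps]. *)
have [L L0 decay] := @expR_geometric_decay R _ _ theta1 eps2.
(* The 2 in the threshold cancels the 4 in the exponent of [normal_prob_tail]. *)
pose F n k := (fun w => B (1 + k.+1%:R / 2 ^+ n) w - B (1 + k%:R / 2 ^+ n) w) @^-1`
  [set y : R | (2 * L * q ^+ n < `|y|)%R].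
have tk n (k : nat) : 0 <= 1 + k%:R / 2 ^+ n :> R.
  by rewrite addr_ge0// divr_ge0// exprn_ge0.
have mA x : measurable [set y : R | (x < `|y|)%R].
  by apply: open_measurable; apply: open_comp (@open_gt _ x) => y _; exact: norm_continuous.
have mF n k : measurable (F n k).
  by rewrite -[F n k]setTI; apply: measurable_increment.
have PF n k : (P (F n k) <= (eps / 2 * (2^-1 / 2) ^+ n)%:E)%E.
  have p2 : 0 < 2 ^+ n :> R by apply: exprn_gt0.
  rewrite /F (bm_normal_increments hB)//; last first.
    by rewrite ltrD2l ltr_pM2r ?invr_gt0// ltr_nat.
  have -> : 1 + k.+1%:R / 2 ^+ n - (1 + k%:R / 2 ^+ n) = 2^-1 ^+ n :> R.
    by rewrite exprVn -natr1; field; rewrite gt_eqF.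
  have h0 : 0 < 2^-1 ^+ n :> R by apply: exprn_gt0.
  apply: (le_trans (normal_prob_tail _ _ _ _ _)).
  - by rewrite sqrtr_gt0.
  - by rewrite !mulr_ge0 ?exprn_ge0// ltW.
  rewrite lee_fin sqr_sqrtr ?(ltW h0)//.
  have -> : (2 * L * q ^+ n) ^+ 2 / (4 * 2^-1 ^+ n) = L ^+ 2 * (2 * q ^+ 2) ^+ n.
    rewrite exprVn [(2 * q ^+ 2) ^+ n]exprMn [q ^+ 2 ^+ n]exprAC; field.
    by rewrite gt_eqF.
  have -> : 2^-1 / 2 = 4^-1 :> R by lra.
  exact: decay.
have rho0 : 0 <= 2^-1 :> R by lra.
have rho1 : 2^-1 < 1 :> R by lra.
have [mG PG] := @probability_binary_tree_le _ _ _ P F _ _ (ltW eps2) rho0 rho1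
  (fun n k _ => mF n k) (fun n k _ => PF n k).
exists (2 * L), (\bigcup_n \big[setU/set0]_(k < 2 ^ n) F n k); split => //.
- by rewrite mulr_ge0// ltW.
- have E : 1 - 2^-1 = 2^-1 :> R by lra.
  by apply: (le_trans PG); rewrite E invrK divfK.
move=> w nG n k kn; rewrite leNgt; apply/negP => Fw; apply: nG.
by exists n => //; rewrite -bigcup_mkord; exists k.
Qed.

(** From time 1 on the increment from 0 has deviation at least 1, so it hits an interval with
    probability at most the length, here [2 * c * (rho / 2) ^+ n]. The term [B 0 w] is kept because
    it vanishes only almost surely. *)
Lemma brownian_avoids (a v : nat -> nat -> R) (c rho : R) :
  0 <= c -> 0 <= rho -> rho < 1 -> (forall n k, 1 <= a n k) ->
  exists H : set T, [/\ measurable H, (P H <= (2 * c / (1 - rho))%:E)%E &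
    forall w, ~ H w -> forall n k, (k < 2 ^ n)%N ->
      c * (rho / 2) ^+ n < `|B (a n k) w - B 0 w - v n k|].
Proof.
move=> c0 rho0 rho1 a1; pose e n := c * (rho / 2) ^+ n.
have e0 n : 0 <= e n by rewrite mulr_ge0// exprn_ge0// divr_ge0.
pose F n k := (fun w => B (a n k) w - B 0 w) @^-1` `[v n k - e n, v n k + e n].
have mF n k : measurable (F n k).
  rewrite -[F n k]setTI; apply: measurable_increment => //.
  exact: le_trans (a1 n k).
have PF n k : (P (F n k) <= (2 * c * (rho / 2) ^+ n)%:E)%E.
  rewrite /F (bm_normal_increments hB)//; last exact: lt_le_trans (a1 n k).
  rewrite subr0; apply: (le_trans (normal_prob_itv_le _ _ _ _ _ _)).
  - by rewrite -[leLHS]sqrtr1 ler_wsqrtr.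
  - by have := e0 n; lra.
  by rewrite lee_fin /e; lra.
have [|mH PH] := @probability_binary_tree_le _ _ _ P F (2 * c) rho _ rho0 rho1
  (fun n k _ => mF n k) (fun n k _ => PF n k); first by rewrite mulr_ge0.
exists (\bigcup_n \big[setU/set0]_(k < 2 ^ n) F n k); split => //.
move=> w nH n k kn; rewrite ltNge; apply/negP => Fw; apply: nH.
exists n => //; rewrite -bigcup_mkord; exists k => //.
rewrite /F /= in_itv /=; move: Fw; rewrite -/(e n) ler_norml => /andP[? ?].
by apply/andP; split; lra.
Qed.

(** Values at negative times are arbitrary, so two-sided continuity is available only at [0 < t]. *)
Lemma brownian_regular_paths : exists N : set T, [/\ measurable N, P N = 0%E &
  forall w, ~ N w -> B 0 w = 0 /\
    forall t, 0 < t -> {for t, continuous (fun t => B t w)}].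
Proof.
have [N [mN PN sN]] := negligibleU (bm_start hB) (bm_continuous hB).
exists N; split => // w nN; split.
  by apply: contrapT => h; apply: nN; apply: sN; left.
move=> t t0.
have cw : {within `[0, +oo[, continuous (fun t => B t w)}.
  by apply: contrapT => h; apply: nN; apply: sN; right.
apply: (@within_continuous_continuous _ _ _ 0 (t + 1)).
- by lra.
- by apply: continuous_subspaceW cw => x /=; rewrite !in_itv/= => /andP[->].
- by rewrite in_itv/= t0; lra.
Qed.

End brownian_events.

(** * Choice of the parameters and assembly of the events *)

Theorem theorem1p2 (R : realType) (d : measure_display) (T : measurableType d)
    (P : probability T R) (B : R -> T -> R)
    (hB : standard_brownian_motion P B)
    (alpha : R) (halpha0 : 0 < alpha) (halpha1 : alpha < 1 / 2) :
  exists f : R -> R,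
    holder_continuous alpha f /\
    with_positive_probability P
      [set w | isolated (zeros (fun t => B t w - f t)) !=set0].
Proof.
(* Above [alpha], so that the union bound converges; below 1/2, so that paths are [beta]-Hölder. *)
pose beta := (alpha + 1 / 2) / 2.
have ab : alpha < beta by rewrite /beta; lra.
have bh : beta < 1 / 2 by rewrite /beta; lra.
have beta0 : 0 < beta by lra.
pose r : R := 2^-1 `^ alpha^-1.
have r0 : 0 < r by apply: powR_gt0.
have r1 : r < 1 / 2.
  rewrite div1r -[ltRHS]powRr1// ltr_half_powR// -(mulr1 alpha^-1).
  by rewrite ltr_pdivlMl// mulr1; lra.
have ra : r `^ alpha = 2^-1 by rewrite -powRrM mulVf ?gt_eqF// powRr1.
pose rho := 2 * r `^ beta.
have rho0 : 0 <= rho by rewrite mulr_ge0// powR_ge0.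
have rho1 : rho < 1.
  rewrite /rho -ltr_pdivlMl// mulr1 -[ltRHS]powRr1// -powRrM ltr_half_powR//.
  by rewrite ltr_pdivlMl// mulr1.
(* The probability [c] of this event is fixed before [l]; the upper bound 1/2 leaves room for the
   move up to time [1 + l]. *)
have mA : measurable ((fun w => B 1 w - B 0 w) @^-1` `]0, 2^-1[).
  rewrite -[X in measurable X]setTI; apply: measurable_funB => //;
    exact: bm_measurable hB _ _.
set A := _ @^-1` _ in mA.
have PA0 : (0 < P A)%E.
  rewrite /A (bm_normal_increments hB)//.
  by apply: normal_prob_itv_gt0; rewrite ?subr0 ?sqrtr1 ?invr_gt0.
have PAc : P A = (fine (P A))%:E by rewrite fineK// fin_num_measure.
move: (fine (P A)) PAc => c PAc.
have c0 : 0 < c by rewrite -lte_fin -PAc.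
have c1 : c <= 1 by rewrite -lee_fin -PAc probability_le1.
have c4 : 0 < c / 4 by lra.
have [K [G [K0 mG PG Ginc]]] := brownian_dyadic_increments _ _ _ _ _ hB _ _ bh c4.
have [C C0 osc] : exists2 C, 0 <= C & forall w, ~ G w ->
    (forall t, 1 <= t <= 2 -> {for t, continuous (fun t => B t w)}) ->
    forall h s t : R, 0 < h -> h <= 1 -> 1 <= s -> s <= t -> t <= 2 ->
      t - s <= h -> `|B t w - B s w| <= C * h `^ beta.
  exists (K * (1 + 2 / (1 - 2^-1 `^ beta)) * 2 `^ beta).
    have q1 : 2^-1 `^ beta < 1.
      by have := ltr_half_powR _ _ _ beta0; rewrite powRr0.
    by rewrite !mulr_ge0 ?powR_ge0// addr_ge0// divr_ge0// subr_ge0 ltW.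
  by move=> w nG cont; exact: dyadic_chaining_holder K0 beta0 cont (Ginc w nG).
(* [2 * e / (1 - rho) = c / 4] bounds the probability of [H], and [e <= 1 / 8] keeps the path below
   [1 / 2 + 1 / 8] at time [1 + l]. *)
have [e [e0 e8 eE]] : exists e, [/\ 0 < e, e <= 1 / 8 & e = c / 8 * (1 - rho)].
  exists (c / 8 * (1 - rho)); split=> //; first by rewrite mulr_gt0; lra.
  by rewrite -[leRHS]mulr1 ler_pM//; lra.
(* [C] is independent of [l], so [l] can be chosen to bring the oscillation bound over [[1, 1 + l]]
   below [e]; the added 1 covers [C = 0]. *)
pose l := (e / (C + 1)) `^ beta^-1.
have C1 : 0 < C + 1 by lra.
have l0 : 0 < l by rewrite powR_gt0// divr_gt0.
have lb : l `^ beta = e / (C + 1).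
  by rewrite /l -powRrM mulVf ?gt_eqF// powRr1// divr_ge0// ltW.
have l1 : l <= 1.
  have h : e / (C + 1) <= 1 by rewrite ler_pdivrMr// mul1r; clear - C0 e8; lra.
  have bV0 : 0 <= beta^-1 by rewrite invr_ge0 ltW.
  have := ge0_ler_powR bV0 _ _ h; rewrite powR1; apply; rewrite nnegrE//.
  by rewrite divr_ge0// ltW.
have Cl : C * l `^ beta <= e.
  by rewrite lb mulrA ler_pdivrMr// mulrC ler_pM2l// lerDl.
have Cl0 : 0 <= C * l `^ beta by rewrite mulr_ge0// powR_ge0.
have le0 n k : 0 <= cantor_left_end r n k.
  by have [] := cantor_left_end_ge0_le _ _ r0 r1 n k.
have [|H [mH PH avoid]] := brownian_avoids _ _ _ _ _ hB
  (fun n k => 1 + l * cantor_left_end r n k)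
  (fun n k => (k%:R + 1 / 2) / 2 ^+ n) _ _ Cl0 rho0 rho1.
  by move=> n k; rewrite lerDl mulr_ge0// ltW.
have [N [mN PN reg]] := brownian_regular_paths _ _ _ _ _ hB.
pose D := (1 - 2 * r) `^ (- alpha).
exists (fun t => cantor r ((t - 1) / l)); split.
  exists (D * l^-1 `^ alpha) => s t _ _.
  apply: (le_trans (cantor_holder _ _ r0 r1 _ (ltW halpha0) ra _ _)).
  rewrite -mulrBl opprB addrA subrK normrM powRM// (ger0_norm (x := l^-1)).
    by rewrite mulrCA mulrC.
  by rewrite invr_ge0 ltW.
(* [G] and [H] cost [c / 4] each and [N] nothing, so at least half of the mass of [A] remains. *)
pose U := G `|` H `|` N.
have mU : measurable U by apply: measurableU => //; exact: measurableU.
have PU : (P U <= (c / 2)%:E)%E.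
  have PH' : (P H <= (c / 4)%:E)%E.
    apply: (le_trans PH); rewrite lee_fin ler_pdivrMr ?subr_gt0//.
    by move: (C * _) Cl => x; rewrite eE; clear; lra.
  have PN' : (P N <= 0)%E by rewrite PN.
  apply: (le_trans (measureU2 P (measurableU _ _ mG mH) mN)).
  apply: (le_trans (leeD (le_trans (measureU2 P mG mH) (leeD PG PH')) PN')).
  by rewrite adde0 -EFinD lee_fin; clear; lra.
exists (A `\` U); split; first exact: measurableD.
  rewrite ltNge; apply/negP => PE.
  have : (P A <= (c / 2)%:E)%E.
    apply: (@le_trans _ _ (P ((A `\` U) `|` U))).
      apply: le_measure; rewrite ?inE//.
        by apply: measurableU => //; exact: measurableD.
      by move=> w Aw; have [Uw|Uw] := pselect (U w); [right|left].
    apply: (le_trans (measureU2 _ (measurableD mA mU) mU)).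
    by rewrite -[leRHS]add0e leeD.
  by rewrite PAc lee_fin; clear - c0; lra.
move=> w [Aw /not_orP[/not_orP[nG nH] nN]] /=.
have [w0 cw] := reg w nN.
have cont t : 1 <= t <= 2 -> {for t, continuous (fun t => B t w)}.
  by move=> /andP[t1 _]; apply: cw; exact: lt_le_trans t1.
have {}osc := osc w nG cont.
move: Aw; rewrite /A /= in_itv/= w0 subr0 => /andP[B0 B1].
apply: (isolated_cantor_crossing _ r l C beta alpha (fun t => B t w)) => //.
(* As [rho / 2] is [r] to the power [beta], the avoidance margin equals the oscillation bound over a
   construction interval. *)
- move=> n k kn; have := avoid w nH n k kn; rewrite w0 subr0.
  rewrite powRM ?exprn_ge0 ?(ltW l0) ?(ltW r0)// mulrA.
  have -> : (r ^+ n) `^ beta = (rho / 2) ^+ n.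
    by rewrite /rho [2 * _]mulrC mulfK// powR_exprn// ltW.
  exact.
- have : `|B (1 + l) w - B 1 w| <= C * l `^ beta by apply: osc; rewrite // ?lerDl ?[1 + l]addrC ?addrK ?(ltW l0)// lerD.
  rewrite ler_norml => /andP[_].
  by move: (C * _) Cl => x; clear - B1 e8; lra.
Qed.
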